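(* There is an absolute constant $c>0$ (independent of the dimension) such that for every $d\ge2$ the operator norm from $\mathbb H^1(\mathbb R^d)$ to $L^1(\mathbb R^d)$ of the maximal function $Mf(x)=\big|\sup_{t>0}\varphi_t*f(x)\big|$ is at least $c\,\frac{d}{\log(d)}$; i.e. $$\sup\Big\{\frac{\|Mf\|_{L^1}}{\|f\|_{\mathbb H^1}}:\ f\in\mathbb H^1(\mathbb R^d)\text{ real-valued},\ f\ne0\Big\}\ \ge\ c\,\frac{d}{\log(d)}.$$
   Context: Kernel: $\varphi$ is the radial function on $\mathbb R^d$ supported in the ball of radius $1+\frac1d$ centered at $0$, whose radial profile is constant on the ball of radius $1$ and decreases linearly to $0$ for $1\le|x|\le1+\frac1d$, normalized so that $\int\varphi=1$; i.e. $\varphi(x)=c_d\max\{0,\min\{1,1+d(1-|x|)\}\}$ with $|x|$ the Euclidean norm. $\varphi_t(x)=t^{-d}\varphi(x/t)$. Dyadic cubes in $\mathbb R^d$ are the cubes $2^n(k+[0,1)^d)$, $n\in\mathbb Z$, $k\in\mathbb Z^d$. $\mathbb E_n f$ equals, on each dyadic cube of sidelength $2^n$, the average of $f$ over that cube. $M^*f=\sup_{n\in\mathbb Z}|\mathbb E_nf|$, $\|f\|_{\mathbb H^1}=\|M^*f\|_{L^1(\mathbb R^d)}$, and $\mathbb H^1(\mathbb R^d)$ is the space of integrable $f$ with $\|f\|_{\mathbb H^1}<\infty$. *)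

(* Defs.v *)
From HB Require Import structures.
From mathcomp Require Import all_boot all_order all_algebra.
From mathcomp Require Import all_classical all_reals all_analysis.

Set Implicit Arguments.
Unset Strict Implicit.
Unset Printing Implicit Defensive.

Import Order.TTheory GRing.Theory Num.Theory.
Import numFieldNormedType.Exports.

Local Open Scope classical_set_scope.
Local Open Scope ring_scope.

(* R^n is [n.-tuple R], with the product of the Borel sigma-algebras. *)
Notation Rn R n := (n.-tuple (measurableTypeR R)).

Section lebesgue_Rn_step.
Context (R : realType) (n : nat).
Variable mu : {sigma_finite_measure set (Rn R n) -> \bar R}.

Definition tcons (p : measurableTypeR R * Rn R n) : Rn R n.+1 :=
  [tuple of p.1 :: p.2].

Lemma measurable_tcons : measurable_fun [set: measurableTypeR R * Rn R n] tcons.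
Proof. exact: measurable_cons. Qed.

Definition lebesgue_Rn_cons : set (Rn R n.+1) -> \bar R :=
  pushforward (lebesgue_measure \x mu)%E tcons.

Let lebesgue_Rn_cons0 : lebesgue_Rn_cons set0 = 0%E.
Proof. by rewrite /lebesgue_Rn_cons /pushforward preimage_set0 measure0. Qed.

Let lebesgue_Rn_cons_ge0 A : (0 <= lebesgue_Rn_cons A)%E.
Proof. by rewrite /lebesgue_Rn_cons /pushforward measure_ge0. Qed.

Let lebesgue_Rn_cons_sigma_additive : semi_sigma_additive lebesgue_Rn_cons.
Proof.
move=> F mF tF mUF; rewrite /lebesgue_Rn_cons /pushforward preimage_bigcup.
have mpre A : measurable A -> measurable (tcons @^-1` A).
  by move=> mA; rewrite -[X in measurable X]setTI; exact: measurable_tcons.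
apply: measure_semi_sigma_additive.
- by move=> k; exact: mpre.
- apply/trivIsetP => /= i j _ _ ij; rewrite -preimage_setI.
  by move/trivIsetP : tF => /(_ _ _ _ _ ij) ->//; rewrite preimage_set0.
- by rewrite -preimage_bigcup; exact: mpre.
Qed.

HB.instance Definition _ := isMeasure.Build _ _ _ lebesgue_Rn_cons
  lebesgue_Rn_cons0 lebesgue_Rn_cons_ge0 lebesgue_Rn_cons_sigma_additive.

Let tuncons (x : Rn R n.+1) : measurableTypeR R * Rn R n :=
  (tnth x ord0, [tuple of behead x]).

Let tconsK : cancel tcons tuncons.
Proof.
move=> [a t]; rewrite /tuncons /tcons /=; congr pair.
exact/val_inj.
Qed.

Let measurable_tuncons : measurable_fun [set: Rn R n.+1] tuncons.
Proof.
apply/measurable_fun_pairP; split.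
  exact: measurable_tnth.
exact: measurable_behead.
Qed.

Let lebesgue_Rn_cons_sigma_finite : sigma_finite setT lebesgue_Rn_cons.
Proof.
have /sigma_finiteP[F [FT ndF Foo]] := sigma_finiteT (@lebesgue_measure R).
have /sigma_finiteP[G [GT ndG Goo]] := sigma_finiteT mu.
exists (fun k => tuncons @^-1` (F k `*` G k)).
  rewrite -preimage_bigcup -(preimage_setT tuncons); congr (_ @^-1` _).
  apply/esym/seteqP; split => // -[a t] _.
  have : [set: measurableTypeR R] a by [].
  have : [set: Rn R n] t by [].
  rewrite FT GT => -[j _ Gjt] [i _ Fia]; exists (maxn i j) => //; split => /=.
    by move: a Fia; exact/subsetPset/ndF/leq_maxl.
  by move: t Gjt; exact/subsetPset/ndG/leq_maxr.
move=> k; have [mF Fkoo] := Foo k; have [mG Gkoo] := Goo k; split.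
  rewrite -[X in measurable X]setTI; apply: measurable_tuncons => //.
  exact: measurableX.
rewrite /lebesgue_Rn_cons /pushforward -comp_preimage.
rewrite (_ : tuncons \o tcons = id) ?preimage_id; last exact/funext/tconsK.
by rewrite product_measure1E// lte_mul_pinfty// ge0_fin_numE.
Qed.

HB.instance Definition _ := Measure_isSigmaFinite.Build _ _ _ lebesgue_Rn_cons
  lebesgue_Rn_cons_sigma_finite.

End lebesgue_Rn_step.

(* The Lebesgue measure on R^n: the n-fold product of [lebesgue_measure]. *)
Fixpoint lebesgue_Rn (R : realType) (n : nat) :
    {sigma_finite_measure set (Rn R n) -> \bar R} :=
  if n is m.+1 then lebesgue_Rn_cons (lebesgue_Rn R m)
  else \d_([tuple] : Rn R 0).

Lemma lebesgue_Rn_box (R : realType) (n : nat)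
    (A : 'I_n -> set (measurableTypeR R)) :
  (forall i, measurable (A i)) ->
  lebesgue_Rn R n [set x | forall i, A i (tnth x i)]
  = (\prod_(i < n) lebesgue_measure (A i))%E.
Proof.
elim: n A => [|n IH] A mA.
  rewrite big_ord0 /= diracE mem_set//; by case.
rewrite big_ord_recl -IH; last by move=> i; exact: mA.
have mB : measurable [set x : Rn R n | forall i, A (lift ord0 i) (tnth x i)].
  rewrite (_ : [set _ | _] = \bigcap_(i in [set: 'I_n])
      ((@tnth n (measurableTypeR R) ^~ i) @^-1` A (lift ord0 i))).
    apply: fin_bigcap_measurable => // i _.
    by rewrite -[X in measurable X]setTI; exact: measurable_tnth.
  by apply/seteqP; split => x /= xA i => [_|]; exact: xA.
rewrite -product_measure1E//=.
rewrite /lebesgue_Rn_cons /pushforward; congr (_ _).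
apply/seteqP; split => -[a t] /=.
  move=> h; split; first by have := h ord0.
  by move=> i; have := h (lift ord0 i); rewrite tnthS.
move=> [ha ht] i; case: (unliftP ord0 i) => [j ->|->//].
by rewrite /tcons tnthS.
Qed.

Section kernel.
Context (R : realType) (d : nat).
Implicit Types (x y : Rn R d) (t : R) (f : Rn R d -> R).
Local Notation mu := (lebesgue_Rn R d).

Definition enorm x : R := Num.sqrt (\sum_(i < d) (tnth x i : R) ^+ 2).

Definition vsub x y : Rn R d := [tuple (tnth x i - tnth y i : R) | i < d].

Definition vscale t x : Rn R d := [tuple (t * tnth x i : R) | i < d].

Definition profile x : R :=
  Num.max 0 (Num.min 1 (1 + d%:R * (1 - enorm x))).

Definition phi x : R := (\int[mu]_y profile y)^-1 * profile x.

Definition dil t x : R := t ^- d * phi (vscale t^-1 x).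

Definition convolution (g f : Rn R d -> R) x : R := \int[mu]_y (g (vsub x y) * f y).

(* The absolute value is outside the supremum; the supremum, and hence [Mmax],
   is extended-real valued. *)
Definition Mmax f x : \bar R :=
  (`| ereal_sup [set (convolution (dil t) f x)%:E | t in [set t : R | (0 < t)%R]] |)%E.

End kernel.

Section dyadic.
Context (R : realType) (d : nat).
Implicit Types (x : Rn R d) (n : int) (f : Rn R d -> R).
Local Notation mu := (lebesgue_Rn R d).

(* 2^n (k + [0,1)^d) *)
Definition dyadic_cube n (k : 'I_d -> int) : set (Rn R d) :=
  [set x | forall i, (2 ^ n * (k i)%:~R <= (tnth x i : R) < 2 ^ n * (k i + 1)%:~R)].

(* The cube of side length 2^n which contains x. *)
Definition dyadic_cube_at n x : set (Rn R d) :=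
  dyadic_cube n (fun i => Num.floor ((2 ^ n)^-1 * (tnth x i : R))).

Definition cond_exp n f x : R :=
  (\int[mu]_(y in dyadic_cube_at n x) f y) / fine (mu (dyadic_cube_at n x)).

Definition dyadic_max f x : \bar R :=
  ereal_sup [set `|cond_exp n f x|%:E | n in [set: int]].

Definition H1_norm f : \bar R := ('N[mu]_1 [dyadic_max f])%E.

Definition H1 : set (Rn R d -> R) :=
  [set f | mu.-integrable setT (EFin \o f) /\ (H1_norm f < +oo)%E].

Lemma dyadic_cube_atP n x (k : 'I_d -> int) :
  dyadic_cube n k x <-> k = (fun i => Num.floor ((2 ^ n)^-1 * (tnth x i : R))).
Proof.
have p0 : 0 < (2 : R) ^ n by exact: exprz_gt0.
split=> [kx|->].
  apply/funext => i; apply/esym/eqP; rewrite floor_eq.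
  by have := kx i; rewrite ler_pdivlMl// ltr_pdivrMl.
by move=> i; rewrite -ler_pdivlMl// -ltr_pdivrMl// floor_le/= floorD1_gt.
Qed.

End dyadic.

(* The operator norm of [Mmax] from H^1 to L^1; f <> 0 is meant in H^1, that is
   modulo equality almost everywhere. *)
Definition Mmax_opnorm (R : realType) (d : nat) : \bar R :=
  ereal_sup [set ('N[lebesgue_Rn R d]_1 [Mmax f] / H1_norm f)%E
            | f in [set f | H1 f /\ ~ {ae lebesgue_Rn R d, forall x, f x = 0}]].

(* Main.v *)
Require Import Defs.
From mathcomp Require Import all_boot all_order all_algebra.
From mathcomp Require Import all_classical all_reals all_analysis.
From mathcomp Require Import measurable_realfun lra.

(* Test the operator on f = 1_Q/|Q| - 1_P/|P|, where Q = [0,2^-m)^d with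
   d^2 <= 2^m <= 4 d^2 and P = [16,32)^d.  Put rho = 1 + 1/d, q = rho^d, so that
   2 <= q <= 4, and let V be the volume of the unit ball.

   For |x| <= rho^(j+1) with j < d, take t = rho^(j+2).  The cube Q has diameter
   at most 1/d, so phi_t(x - .) is constant on Q, while it vanishes on the distant
   cube P.  Hence Mf(x) >= t^-d c_d >= q^-(j+2) / (q V).  The shell
   rho^j < |x| <= rho^(j+1) has measure (q^(j+1) - q^j) V, so each of the d shells
   contributes at least (q - 1)/q^3 >= 1/64 to the L^1 norm of Mf.

   Conversely E_n f = 0 for n >= 5, and for n <= 4 the nesting of the dyadic cubes
   bounds |E_n f| by one of the m+5 normalized indicators of the cubes [0,2^k)^d,
   -m <= k <= 4, plus that of P.  Thus the H^1 norm of f is at most m + 6, which is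
   O(log d). *)

Set Implicit Arguments.
Unset Strict Implicit.
Unset Printing Implicit Defensive.
Import Order.TTheory GRing.Theory Num.Theory.
Import numFieldNormedType.Exports.
Local Open Scope classical_set_scope.
Local Open Scope ring_scope.

(* [ge0_le_integral] asks for measurability, which is not established for the
   two maximal functions. *)
Lemma le_ge0_integralT dT (T : measurableType dT) (R : realType)
    (mu : {measure set T -> \bar R}) (f g : T -> \bar R) :
  (forall x, 0 <= f x)%E -> (forall x, f x <= g x)%E ->
  (\int[mu]_x f x <= \int[mu]_x g x)%E.
Proof.
move=> f0 fg; have g0 x : (0 <= g x)%E by exact: le_trans (f0 x) (fg x).
rewrite !ge0_integralTE//; apply: le_ereal_sup => _ [h /= hf <-].
by exists h => // x; exact: le_trans (hf x) (fg x).
Qed.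

(** * Scaling of Lebesgue measure under dilations *)

Section dilation.
Variable R : realType.
Implicit Types (r : R) (n : nat).

(** Uniqueness of Lebesgue measure: the right-hand side is a measure in [A] that gives half-open
    intervals their length. *)
Lemma lebesgue_measure_dilation r (A : set (measurableTypeR R)) :
  0 < r -> measurable A ->
  lebesgue_measure A =
  (r%:E * lebesgue_measure [set x : measurableTypeR R | A (r * x)%R])%E.
Proof.
move=> r0 mA.
have mr : measurable_fun setT
    ((fun x => r * x) : measurableTypeR R -> measurableTypeR R).
  exact: mulrl_measurable.
pose nu : {measure set (measurableTypeR R) -> \bar R} :=
  mscale (NngNum (ltW r0)) (pushforward (@lebesgue_measure R)
    ((fun x => r * x) : measurableTypeR R -> measurableTypeR R)).
have := @lebesgue_measure_unique R (nu mr) _ A mA; apply => X [[a b] _ <-].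
rewrite /nu /= /mscale /= /pushforward /=.
rewrite (_ : _ @^-1` _ = `]r^-1 * a, r^-1 * b]%classic); last first.
  apply/seteqP; split => x /=; rewrite !in_itv /=;
    by rewrite ltr_pdivrMl// ler_pdivlMl.
rewrite !lebesgue_measure_itv /= !lte_fin ltr_pM2l ?invr_gt0//.
case: ifPn => ab; last by rewrite mule0.
by rewrite -!EFinB -EFinM -mulrBr mulVKf// gt_eqF.
Qed.

Lemma measurable_vscale n r : measurable_fun setT (@vscale R n r).
Proof.
apply/measurable_fun_tnthP => i.
rewrite (_ : _ \o _ = (fun y => r * y) \o (@tnth n (measurableTypeR R) ^~ i)).
  by apply: measurableT_comp; [exact: mulrl_measurable|exact: measurable_tnth].
by apply/funext => x /=; rewrite tnth_mktuple.
Qed.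

Lemma vscale_cons n r (a : R) (t : Rn R n) :
  vscale r (tcons (a, t)) = tcons (r * a, vscale r t).
Proof.
apply: eq_from_tnth => i; rewrite tnth_mktuple.
case: (unliftP ord0 i) => [j ->|->//].
by rewrite /tcons !tnthS tnth_mktuple.
Qed.

(** Induction on the dimension. By uniqueness of product measures it suffices to test rectangles,
    where the first coordinate contributes the factor [r] and the others [r ^+ n]. *)
Lemma lebesgue_Rn_dilation n r (A : set (Rn R n)) :
  0 < r -> measurable A ->
  lebesgue_Rn R n A = ((r ^+ n)%:E * lebesgue_Rn R n (vscale r @^-1` A))%E.
Proof.
move=> r0; elim: n A => [|n IH] A mA.
  rewrite expr0 mul1e; congr (lebesgue_Rn R 0 _).
  by apply/seteqP; split => x /=; rewrite (tuple0 x) (tuple0 (vscale _ _)).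
pose s (p : measurableTypeR R * Rn R n) : measurableTypeR R * Rn R n :=
  (r * p.1, vscale r p.2).
have ms : measurable_fun setT s.
  apply/measurable_fun_pairP; split.
    apply: (measurableT_comp (f := fun x => r * x)).
      exact: mulrl_measurable.
    exact: measurable_fst.
  apply: (measurableT_comp (f := vscale r)).
    exact: measurable_vscale.
  exact: measurable_snd.
have rn0 : 0 <= r ^+ n.+1 by exact/exprn_ge0/ltW.
pose nu : {measure set (measurableTypeR R * Rn R n) -> \bar R} :=
  mscale (NngNum rn0) (pushforward (lebesgue_measure \x lebesgue_Rn R n)%E s).
have mA' : measurable (@tcons R n @^-1` A).
  by rewrite -[X in measurable X]setTI; exact: measurable_tcons.
transitivity (nu ms (@tcons R n @^-1` A)).
  apply: (@product_measure_unique _ _ _ _ _ _ _ (nu ms)) => // B C mB mC.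
  rewrite /nu /= /mscale /= /pushforward /=.
  rewrite (_ : s @^-1` _ = [set x : measurableTypeR R | B (r * x)%R] `*`
    (vscale r @^-1` C))//.
  rewrite product_measure1E//; last 2 first.
    rewrite -[X in measurable X]setTI.
    exact: (mulrl_measurable r).
    by rewrite -[X in measurable X]setTI; exact: measurable_vscale.
  rewrite (lebesgue_measure_dilation r0 mB) (IH _ mC).
  by rewrite exprS EFinM muleACA.
rewrite /nu /= /mscale /= /pushforward /= /lebesgue_Rn_cons /pushforward.
congr (_ * (_ \x _) _)%E.
by apply/seteqP; split => -[a t] /=; rewrite -vscale_cons.
Qed.
End dilation.

(** * The Euclidean norm and volumes of balls *)

Section euclidean_norm.
Context (R : realType) (d : nat).
Implicit Types (x y : Rn R d) (r t : R).
Local Notation mu := (lebesgue_Rn R d).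

Lemma enorm_ge0 x : 0 <= enorm x.
Proof. exact: sqrtr_ge0. Qed.

Lemma sqr_enorm x : enorm x ^+ 2 = \sum_(i < d) (tnth x i : R) ^+ 2.
Proof. by rewrite sqr_sqrtr// sumr_ge0// => i _; exact: sqr_ge0. Qed.

Lemma enorm_le x r : 0 <= r ->
  (enorm x <= r) = (\sum_(i < d) (tnth x i : R) ^+ 2 <= r ^+ 2).
Proof. by move=> r0; rewrite -sqr_enorm ler_sqr// nnegrE enorm_ge0. Qed.

Lemma tnth_le_enorm x i : `|tnth x i : R| <= enorm x.
Proof.
rewrite -ler_sqr ?nnegrE ?enorm_ge0 ?normr_ge0// sqr_enorm real_normK ?num_real//.
by rewrite (bigD1 i)//= lerDl sumr_ge0// => j _; exact: sqr_ge0.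
Qed.

Lemma enorm_vscale t x : 0 <= t -> enorm (vscale t x) = t * enorm x.
Proof.
move=> t0; apply/eqP; rewrite -(@eqrXn2 _ 2) ?mulr_ge0 ?enorm_ge0//.
rewrite exprMn !sqr_enorm mulr_sumr; apply/eqP/eq_bigr => i _.
by rewrite tnth_mktuple exprMn.
Qed.

(* Weaker than the triangle inequality, but it needs no Cauchy-Schwarz. *)
Lemma enorm_vsub_le x y :
  enorm (vsub x y) <= enorm x + \sum_(i < d) `|tnth y i : R|.
Proof.
set l : R := \sum_(i < d) _.
have l0 : 0 <= l by exact: sumr_ge0.
have x0 := enorm_ge0 x.
have yl i : `|tnth y i : R| <= l by rewrite /l (bigD1 i)//= lerDl sumr_ge0.
rewrite enorm_le ?addr_ge0//.
rewrite (_ : (enorm x + l) ^+ 2 = \sum_(i < d)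
    ((tnth x i : R) ^+ 2 + `|tnth y i : R| * (enorm x *+ 2 + l))); last first.
  rewrite big_split /= -sqr_enorm -mulr_suml -/l sqrrD -addrA; congr (_ + _).
  by move: (enorm x) => u; nra.
apply: ler_sum => i _; rewrite tnth_mktuple.
have := yl i; have := tnth_le_enorm x i.
move: (tnth x i : R) (tnth y i : R) (enorm x) => a b e ae bl.
have h1 : - (a * b) <= e * `|b|.
  by rewrite (le_trans (ler_norm _))// normrN normrM ler_wpM2r.
have h2 : b * b <= `|b| * l.
  by rewrite -expr2 -(real_normK (num_real b)) expr2 ler_wpM2l.
by rewrite !expr2; lra.
Qed.

Definition eball r : set (Rn R d) := [set x | enorm x <= r].

Lemma measurable_eball r : measurable (eball r).
Proof.
have [r0|r0] := ltP r 0.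
  rewrite (_ : eball r = set0)//; apply/seteqP; split => // x /=.
  by rewrite /eball /= leNgt (lt_le_trans r0 (enorm_ge0 x)).
have ms : measurable_fun setT (fun x : Rn R d => \sum_(i < d) (tnth x i : R) ^+ 2).
  apply: measurable_sum => i; apply: measurable_funX.
  exact: measurable_tnth.
rewrite (_ : eball r = setT `&` ((fun x : Rn R d => \sum_(i < d) (tnth x i : R) ^+ 2)
    @^-1` `]-oo, (r ^+ 2)])); first by apply: ms => //; exact: measurable_itv.
by apply/seteqP; split => x; rewrite /eball /= in_itv /= enorm_le// => -[].
Qed.

Lemma measurable_box (A : 'I_d -> set (measurableTypeR R)) :
  (forall i, measurable (A i)) ->
  measurable [set x : Rn R d | forall i, A i (tnth x i)].
Proof.
move=> mA; rewrite (_ : [set _ | _] = \bigcap_(i in [set: 'I_d])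
    ((@tnth d (measurableTypeR R) ^~ i) @^-1` A i)).
  apply: fin_bigcap_measurable => // i _.
  by rewrite -[X in measurable X]setTI; exact: measurable_tnth.
by apply/seteqP; split => x xA i => [_|]; exact: xA.
Qed.

(** Stays symbolic throughout: it cancels between the normalization of [phi] and the measures of the
    shells. *)
Definition unit_ball_volume : R := fine (mu (eball 1)).
Local Notation V := unit_ball_volume.

(** Used at two scales: the box with [r = 1] encloses the unit ball and makes its volume finite, the
    box with [r = 1/d] is inscribed and makes it positive. *)
Let symmetric_box r : 0 <= r ->
  mu [set x : Rn R d | forall i, `[- r, r]%classic (tnth x i : R)] = ((r *+ 2) ^+ d)%:E.
Proof.
move=> r0; rewrite (lebesgue_Rn_box (A := fun=> `[- r, r]%classic)); last first.
  by move=> i; exact: measurable_itv.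
rewrite (eq_bigr (fun=> (r *+ 2)%:E)); last first.
  move=> i _; rewrite lebesgue_measure_itv /= lte_fin.
  have [r0'|] := ltP; first by rewrite -EFinB opprK mulr2n.
  by move=> ?; rewrite (_ : r = 0) ?mul0rn; last lra.
by rewrite prodEFin prodr_const card_ord.
Qed.

Lemma eball1E : mu (eball 1) = V%:E.
Proof.
rewrite fineK// ge0_fin_numE//.
have := symmetric_box ler01 => /esym mb.
apply: (@le_lt_trans _ _ ((1 *+ 2) ^+ d)%:E); last exact: ltry.
rewrite mb; apply: le_measure; rewrite ?inE.
- exact: measurable_eball.
- apply: (@measurable_box (fun=> `[(-1)%R, 1%R]%classic)) => i.
  exact: measurable_itv.
- move=> x /= x1 i; rewrite in_itv /= -ler_norml.
  exact: le_trans (tnth_le_enorm x i) x1.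
Qed.

Lemma unit_ball_volume_gt0 : (0 < d)%N -> 0 < V.
Proof.
move=> d0; have dR : 0 < d%:R :> R by rewrite ltr0n.
have r0 : 0 <= d%:R^-1 :> R by rewrite invr_ge0 ltW.
rewrite -lte_fin -eball1E.
apply: (@lt_le_trans _ _ ((d%:R^-1 *+ 2) ^+ d)%:E).
  by rewrite lte_fin exprn_gt0// pmulrn_lgt0 ?invr_gt0.
rewrite -symmetric_box//; apply: le_measure; rewrite ?inE.
- apply: (@measurable_box (fun=> `[(- d%:R^-1)%R, d%:R^-1%R]%classic)) => i.
  exact: measurable_itv.
- exact: measurable_eball.
- move=> x /= xd; rewrite /eball /= enorm_le//.
  (* Each square is at most 1/d^2 <= 1/d, and d copies of 1/d add up to 1. *)
  apply: (@le_trans _ _ (\sum_(i < d) d%:R^-1)).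
    apply: ler_sum => i _; have := xd i; rewrite in_itv /= -ler_norml => xi.
    rewrite -(real_normK (num_real (tnth x i : R))) expr2.
    rewrite -[leRHS]mul1r ler_pM// (le_trans xi)// invf_le1// ler1n//.
  by rewrite sumr_const card_ord -[_^-1 *+ d]mulr_natl divff ?gt_eqF// expr1n.
Qed.

Lemma mu_eball r : 0 < r -> mu (eball r) = (r ^+ d * V)%:E.
Proof.
move=> r0; rewrite (lebesgue_Rn_dilation r0 (measurable_eball r)) EFinM -eball1E.
rewrite (_ : vscale r @^-1` eball r = eball 1)//.
by apply/seteqP; split => x; rewrite /eball /= (enorm_vscale _ (ltW r0));
  rewrite -ler_pdivlMl// mulVf ?gt_eqF.
Qed.

End euclidean_norm.
Arguments eball {R d} r _.
Arguments unit_ball_volume : clear implicits.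

(** * The kernel profile and its integral *)

Section profile.
Context (R : realType) (d : nat).
Hypothesis d0 : (0 < d)%N.
Implicit Types (x y : Rn R d).
Local Notation mu := (lebesgue_Rn R d).
Local Notation V := (unit_ball_volume R d).
Local Notation rho := (1 + d%:R^-1 : R).

Let dR : 0 < d%:R :> R. Proof. by rewrite ltr0n. Qed.

Lemma profile_ge0 x : 0 <= profile x.
Proof. by rewrite /profile le_max lexx. Qed.

Lemma profile_le1 x : profile x <= 1.
Proof. by rewrite /profile ge_max ler01 ge_min lexx. Qed.

Lemma profile_eball1 x : enorm x <= 1 -> profile x = 1.
Proof.
move=> x1; rewrite /profile min_l ?max_r// lerDl mulr_ge0// subr_ge0//.
Qed.

Lemma profile_out x : rho <= enorm x -> profile x = 0.
Proof.
move=> x1; rewrite /profile max_l// ge_min; apply/orP; right.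
have : d%:R * rho <= d%:R * enorm x by rewrite ler_pM2l.
by rewrite mulrDr mulr1 divff ?gt_eqF//; lra.
Qed.

(** The profile lies between the indicators of the balls of radius 1 and [rho]. *)
Lemma integral_profile_bounds :
  V <= (\int[mu]_y profile y)%R <= rho ^+ d * V.
Proof.
have rho0 : 0 < rho by rewrite addr_gt0// invr_gt0.
have h1 : (V%:E <= \int[mu]_y (profile y)%:E)%E.
  rewrite -eball1E -(setIT (eball 1)) -integral_indic//;
    last exact: measurable_eball.
  apply: le_ge0_integralT => x; rewrite ?lee_fin ?indicE//.
  case: (boolP (x \in _)) => [|_]; last exact: profile_ge0.
  by rewrite inE => /profile_eball1 ->.
have h2 : (\int[mu]_y (profile y)%:E <= (rho ^+ d * V)%:E)%E.
  rewrite -mu_eball// -(setIT (eball rho)) -integral_indic//;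
    last exact: measurable_eball.
  apply: le_ge0_integralT => x; rewrite ?lee_fin ?profile_ge0//.
  rewrite indicE; case: (boolP (x \in _)) => [_|]; first exact: profile_le1.
  by rewrite notin_setE /eball /= => /negP; rewrite -ltNge => /ltW/profile_out ->.
(* The real-valued integral is the [fine] part of the extended one, so finiteness must be known
   before the bounds transfer. *)
have fin : (\int[mu]_y (profile y)%:E)%E \is a fin_num.
  rewrite ge0_fin_numE; first exact: le_lt_trans h2 (ltry _).
  by apply: integral_ge0 => x _; rewrite lee_fin profile_ge0.
by rewrite /Rintegral -!lee_fin (fineK fin) h1.
Qed.

End profile.

(** * Nesting of dyadic cubes and measures of their intersections *)

Section dyadic_cubes.
Context (R : realType) (d : nat).
Implicit Types (x y z : Rn R d) (n k : int).
Local Notation mu := (lebesgue_Rn R d).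
Local Notation vol n := ((2 ^ n : R) ^+ d).

Lemma dyadic_cube_at_refl n x : dyadic_cube_at n x x.
Proof. exact/dyadic_cube_atP. Qed.

Lemma dyadic_cube_at_eq n x y :
  dyadic_cube_at n x y -> dyadic_cube_at n y = dyadic_cube_at n x.
Proof. by rewrite /dyadic_cube_at => /dyadic_cube_atP <-. Qed.

Lemma dyadic_cube_at_sym n x y : dyadic_cube_at n x y -> dyadic_cube_at n y x.
Proof. by move=> /dyadic_cube_at_eq ->; exact: dyadic_cube_at_refl. Qed.

Lemma dyadic_cubeE n (k : 'I_d -> int) : dyadic_cube n k =
  [set x : Rn R d | forall i,
    `[(2 ^ n * (k i)%:~R)%R, (2 ^ n * (k i + 1)%:~R)%R[%classic (tnth x i : R)].
Proof. by apply/seteqP; split => x /= xk i; have := xk i; rewrite in_itv. Qed.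

Lemma measurable_dyadic_cube n (k : 'I_d -> int) :
  measurable (dyadic_cube n k : set (Rn R d)).
Proof.
rewrite dyadic_cubeE.
apply: (@measurable_box _ _ (fun i =>
  `[(2 ^ n * (k i)%:~R)%R, (2 ^ n * (k i + 1)%:~R)%R[%classic)) => i.
exact: measurable_itv.
Qed.

Lemma mu_dyadic_cube n (k : 'I_d -> int) : mu (dyadic_cube n k) = (vol n)%:E.
Proof.
rewrite dyadic_cubeE.
rewrite (@lebesgue_Rn_box _ _ (fun i =>
  `[(2 ^ n * (k i)%:~R)%R, (2 ^ n * (k i + 1)%:~R)%R[%classic)); last first.
  by move=> i; exact: measurable_itv.
rewrite (eq_bigr (fun=> (2 ^ n : R)%:E)).
  by rewrite prodEFin prodr_const card_ord.
move=> i _; rewrite lebesgue_measure_itv /= lte_fin.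
rewrite ltr_pM2l ?exprz_gt0// ltr_int ltrDl ltr01 -EFinB -mulrBr.
by rewrite intrD addrAC subrr add0r mulr1.
Qed.

Lemma measurable_dyadic_cube_at n x : measurable (dyadic_cube_at n x).
Proof. exact: measurable_dyadic_cube. Qed.

Lemma mu_dyadic_cube_at n x : mu (dyadic_cube_at n x) = (vol n)%:E.
Proof. exact: mu_dyadic_cube. Qed.

Lemma vol_gt0 n : 0 < vol n. Proof. by rewrite exprn_gt0// exprz_gt0. Qed.

Lemma dyadic_cube_at_nested n k x : (n <= k)%R ->
  dyadic_cube_at n x `<=` dyadic_cube_at k x.
Proof.
move=> nk y yx i.
have [j kE] : exists j : nat, k = n + j%:Z.
  by exists `|k - n|%N; rewrite gez0_abs ?subr_ge0// addrCA subrr addr0.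
rewrite /dyadic_cube_at /dyadic_cube /=; have /= := yx i.
set N := Num.floor (_ * tnth x i); set K := Num.floor (_ * tnth x i) => /andP[Ny yN].
have p0 : 0 < (2 ^ n : R) by rewrite exprz_gt0.
have kn : (2 ^ k : R) = 2 ^ n * (2 ^+ j : int)%:~R.
  by rewrite kE expfzDr ?pnatr_eq0// rmorphXn.
have q0 : 0 < (2 ^ k : R) by rewrite exprz_gt0.
(* With 2^k = 2^n 2^j, the index interval [N, N+1) of the fine cube must lie in [2^j K, 2^j (K+1));
   integrality of N turns the strict upper bound into [NK]. *)
have KN : 2 ^+ j * K <= N.
  rewrite /N floor_ge_int intrM ler_pdivlMl// mulrA -kn -ler_pdivlMl//.
  exact: floor_le.
have NK : N + 1 <= 2 ^+ j * (K + 1).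
  rewrite lezD1 /N floor_lt_int intrM ltr_pdivrMl// mulrA -kn -ltr_pdivrMl//.
  exact: floorD1_gt.
rewrite kn -!mulrA -!intrM; apply/andP; split.
  by rewrite (le_trans _ Ny)// ler_pM2l// ler_int.
by rewrite (lt_le_trans yN)// ler_pM2l// ler_int.
Qed.

(** By nesting, the finer cube at [x] is either contained in the coarser cube at [y] or disjoint
    from it, according to whether [x] lies in the latter. *)
Lemma mu_dyadic_cube_atI n k x y : (n <= k)%R ->
  mu (dyadic_cube_at k y `&` dyadic_cube_at n x)
  = (vol n * \1_(dyadic_cube_at k y) x)%:E.
Proof.
move=> nk; rewrite indicE; case: (boolP (x \in _)) => [|].
  rewrite inE mulr1 => /dyadic_cube_at_eq <-; rewrite setIidr ?mu_dyadic_cube_at//.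
  exact: dyadic_cube_at_nested.
rewrite notin_setE mulr0 => yx.
rewrite (_ : _ `&` _ = set0) ?measure0//; apply/seteqP; split => // z [yz xz].
apply: yx; rewrite -(dyadic_cube_at_eq yz); apply: (dyadic_cube_at_nested nk).
exact: dyadic_cube_at_sym.
Qed.

(** The mirror case, with the cube at [x] the coarser one. Symmetry of sharing a cube puts the
    result again in the form of an indicator evaluated at [x]. *)
Lemma mu_dyadic_cube_atI_ge n k x y : (k <= n)%R ->
  mu (dyadic_cube_at k y `&` dyadic_cube_at n x)
  = (vol k * \1_(dyadic_cube_at n y) x)%:E.
Proof.
move=> kn; rewrite setIC mu_dyadic_cube_atI// !indicE; congr (_ * (nat_of_bool _)%:R)%:E.
by apply/idP/idP; rewrite !inE; exact: dyadic_cube_at_sym.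
Qed.

End dyadic_cubes.

(** * Integrals of combinations of two indicators *)

Section indicators.
Context dT (T : measurableType dT) (R : realType) (mu : {measure set T -> \bar R}).
Implicit Types (A B D : set T) (a b : R).

Lemma integrableZ_indic D A a : measurable D -> measurable A -> (mu A < +oo)%E ->
  mu.-integrable D (fun x => (a * \1_A x)%:E).
Proof.
move=> mD mA Aoo; apply/integrableP; split.
  exact/measurable_EFinP/measurable_funM.
under eq_integral do rewrite abse_EFin normrM (ger0_norm (_ : 0 <= \1_A _))// EFinM.
rewrite ge0_integralZl_EFin//; last exact/measurable_EFinP/measurable_indic.
rewrite integral_indic// lte_mul_pinfty// (le_lt_trans _ Aoo)//.
by rewrite le_measure ?inE//; exact: measurableI.
Qed.

(** Serves both the dyadic averages of the test function, with [D] a cube, and its convolutions,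
    with [D] the whole space. *)
Lemma Rintegral_sub_indic D A B a b : measurable D ->
  measurable A -> measurable B -> (mu A < +oo)%E -> (mu B < +oo)%E ->
  (\int[mu]_(x in D) (a * \1_A x - b * \1_B x))%R
  = a * fine (mu (A `&` D)) - b * fine (mu (B `&` D)).
Proof.
move=> mD mA mB Aoo Boo.
rewrite RintegralB//; try exact: integrableZ_indic.
have h C c : measurable C -> (mu C < +oo)%E ->
    (\int[mu]_(x in D) (c * \1_C x))%R = c * fine (mu (C `&` D)).
  move=> mC Coo; rewrite RintegralZl//.
    by rewrite /Rintegral integral_indic.
  rewrite (_ : EFin \o _ = fun x => (1 * \1_C x)%:E).
    exact: integrableZ_indic.
  by apply/funext => x /=; rewrite mul1r.
by rewrite !h.
Qed.

End indicators.

(** * The test function and the upper bound on its H^1 norm *)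

Section test_function.
Context (R : realType) (d m : nat).
Implicit Types (x y : Rn R d) (n : int).
Local Notation mu := (lebesgue_Rn R d).
Local Notation vol n := ((2 ^ n : R) ^+ d).

(** The lower corners of Q and P are such points; presenting both cubes as [dyadic_cube_at] a point
    makes the intersection formulas apply. *)
Definition diag_pt (a : R) : Rn R d := [tuple (a : measurableTypeR R) | i < d].

(* Q = [0,2^-m)^d and P = [16,32)^d. *)
Definition near_cube : set (Rn R d) := dyadic_cube_at (- m%:Z) (diag_pt 0).
Definition far_cube : set (Rn R d) := dyadic_cube_at 4%:Z (diag_pt 16).

Definition test_fun x : R :=
  (vol (- m%:Z))^-1 * \1_near_cube x - (vol 4%:Z)^-1 * \1_far_cube x.

Lemma measurable_near_cube : measurable near_cube.
Proof. exact: measurable_dyadic_cube_at. Qed.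

Lemma measurable_far_cube : measurable far_cube.
Proof. exact: measurable_dyadic_cube_at. Qed.

Lemma mu_near_cube : mu near_cube = (vol (- m%:Z))%:E.
Proof. exact: mu_dyadic_cube_at. Qed.

Lemma mu_far_cube : mu far_cube = (vol 4%:Z)%:E.
Proof. exact: mu_dyadic_cube_at. Qed.

Lemma mu_near_cube_fin : (mu near_cube < +oo)%E.
Proof. by rewrite mu_near_cube ltry. Qed.

Lemma mu_far_cube_fin : (mu far_cube < +oo)%E.
Proof. by rewrite mu_far_cube ltry. Qed.

Lemma near_cube_itv y i : near_cube y -> 0 <= (tnth y i : R) < 2 ^ (- m%:Z).
Proof.
move=> /(_ i); rewrite tnth_mktuple mulr0 (_ : Num.floor 0 = 0) ?floor0//.
by rewrite mulr0 add0r mulr1.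
Qed.

Lemma exp2_4 : (2 ^ 4%:Z : R) = 16. Proof. by rewrite -exprnP -natrX. Qed.

Lemma far_cube_ge y i : far_cube y -> 16 <= (tnth y i : R).
Proof.
move=> /(_ i); rewrite tnth_mktuple exp2_4 mulVf ?pnatr_eq0//.
by rewrite floor1 mulr1 => /andP[].
Qed.

Lemma integrable_test_fun : mu.-integrable setT (EFin \o test_fun).
Proof.
rewrite (_ : _ \o _ = (fun x => ((vol (- m%:Z))^-1 * \1_near_cube x)%:E)
  \- (fun x => ((vol 4%:Z)^-1 * \1_far_cube x)%:E))%E//.
apply: integrableB => //.
- apply: integrableZ_indic => //; first exact: measurable_near_cube.
  exact: mu_near_cube_fin.
- apply: integrableZ_indic => //; first exact: measurable_far_cube.
  exact: mu_far_cube_fin.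
Qed.

Lemma test_fun_neq0 : (0 < d)%N -> ~ {ae mu, forall x, test_fun x = 0}.
Proof.
move=> d0 [A [mA A0 sA]].
have : (mu near_cube <= mu A)%E.
  apply: le_measure; rewrite ?inE//; first exact: measurable_near_cube.
  move=> x nx; apply: sA => /= /eqP; apply/negP.
  (* Q and P are disjoint: coordinates are below 2^-m <= 1 on Q and at least 16 on P. *)
  have nfx : ~ far_cube x.
    move=> /(far_cube_ge (Ordinal d0)); apply/negP; rewrite -ltNge.
    have /andP[_ /lt_le_trans] := near_cube_itv (Ordinal d0) nx; apply.
    rewrite -invr_expz -exprnP (@le_trans _ _ 1) ?ler1n//.
    by rewrite invf_le1 ?exprn_gt0// exprn_ege1 ?ler1n.
  rewrite /test_fun !indicE mem_set// memNset// mulr1 mulr0 subr0.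
  by rewrite invr_eq0 gt_eqF// vol_gt0.
by rewrite A0 mu_near_cube lee_fin leNgt vol_gt0.
Qed.

Lemma cond_exp_test_fun n x (C := dyadic_cube_at n x) :
  cond_exp n test_fun x =
  ((vol (- m%:Z))^-1 * fine (mu (near_cube `&` C))
   - (vol 4%:Z)^-1 * fine (mu (far_cube `&` C))) / vol n.
Proof.
rewrite /cond_exp /C (Rintegral_sub_indic _ _ (measurable_dyadic_cube_at n x)
  measurable_near_cube measurable_far_cube mu_near_cube_fin mu_far_cube_fin).
by rewrite mu_dyadic_cube_at.
Qed.

(** From side 32 on, the dyadic cube at the origin contains both Q and P, so every cube of that size
    sees both masses, which cancel, or neither. *)
Lemma cond_exp_test_fun_coarse n x : 5%:Z <= n -> cond_exp n test_fun x = 0.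
Proof.
move=> n5; rewrite cond_exp_test_fun /near_cube /far_cube !mu_dyadic_cube_atI_ge; last 2 first.
- by rewrite (le_trans _ n5).
- by rewrite (le_trans _ n5)// (@le_trans _ _ 0)// oppr_le0.
rewrite /= !mulKf ?gt_eqF ?vol_gt0//.
rewrite (@dyadic_cube_at_eq _ _ n (diag_pt 0) (diag_pt 16)) ?subrr ?mul0r//.
apply: (dyadic_cube_at_nested n5) => i; rewrite !tnth_mktuple mulr0 floor0.
rewrite mulr0 add0r mulr1 -exprnP -natrX; apply/andP; split => //.
by rewrite ltr_nat.
Qed.

(** The bound is independent of [n], hence passes to the supremum. For each [n] the average of the Q
    part equals a single summand, and the others are nonnegative. *)
Lemma cond_exp_test_fun_fine n x : n <= 4%:Z ->
  `|cond_exp n test_fun x| <=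
  \sum_(j < m + 5) (vol (j%:Z - m%:Z))^-1
    * \1_(dyadic_cube_at (j%:Z - m%:Z) (diag_pt 0)) x
  + (vol 4%:Z)^-1 * \1_far_cube x.
Proof.
move=> n4; rewrite cond_exp_test_fun /near_cube /far_cube mulrBl (le_trans (ler_normB _ _))//.
have v0 k : 0 < vol k by exact: vol_gt0.
have t0 k y : 0 <= (vol k)^-1 * \1_(dyadic_cube_at k y) x.
  by rewrite mulr_ge0// invr_ge0 ltW.
rewrite !ger0_norm; last 2 first.
- by rewrite !mulr_ge0 ?invr_ge0 ?fine_ge0// ltW.
- by rewrite !mulr_ge0 ?invr_ge0 ?fine_ge0// ltW.
apply: lerD; last first.
  by rewrite mu_dyadic_cube_atI//= -mulrA mulrAC divff ?mul1r// gt_eqF.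
(* Cubes no larger than Q lie in Q or miss it: averaging leaves the normalized indicator of Q
   unchanged, which is the term of index 0. *)
have [nm|mn] := leP n (- m%:Z).
  rewrite (_ : m + 5 = (m + 4).+1)%N ?addnS// (bigD1 ord0)//= sub0r mu_dyadic_cube_atI//=.
  rewrite -mulrA mulrAC divff ?mul1r ?gt_eqF// lerDl sumr_ge0//.
(* For -m < n <= 4 averaging spreads the mass of Q over the cube of side 2^n at the origin, which is
   the term of index n + m. *)
have [j jE] : exists j : nat, j%:Z = n + m%:Z.
  exists (absz (n + m%:Z)); rewrite gez0_abs//.
  by rewrite -[m%:Z]opprK subr_ge0 ltW.
have nE : n = j%:Z - m%:Z by rewrite jE addrK.
have jm : (j < m + 5)%N.
  by rewrite -ltz_nat jE PoszD addrC ltrD2l (le_lt_trans n4).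
rewrite (bigD1 (Ordinal jm))//= -nE (mu_dyadic_cube_atI_ge _ _ (ltW mn))/=.
by rewrite mulKf ?gt_eqF// mulrC lerDl sumr_ge0.
Qed.

Lemma dyadic_max_test_fun x :
  (0 <= dyadic_max test_fun x <=
  (\sum_(j < m + 5) (vol (j%:Z - m%:Z))^-1
    * \1_(dyadic_cube_at (j%:Z - m%:Z) (diag_pt 0)) x
  + (vol 4%:Z)^-1 * \1_far_cube x)%:E)%E.
Proof.
apply/andP; split.
  apply: (@le_trans _ _ `|cond_exp 0 test_fun x|%:E); first by rewrite lee_fin.
  by apply: ereal_sup_ubound; exists 0.
apply: ge_ereal_sup => _ [n _ <-]; rewrite lee_fin.
have [n4|n4] := leP n 4%:Z; first exact: cond_exp_test_fun_fine.
rewrite cond_exp_test_fun_coarse; last by rewrite -lezD1 in n4.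
by rewrite normr0 addr_ge0 ?sumr_ge0// => *; rewrite mulr_ge0// invr_ge0 ltW ?vol_gt0.
Qed.

(** Each of the (m + 5) + 1 normalized indicators in the pointwise bound has integral 1. *)
Lemma H1_norm_test_fun : (H1_norm test_fun <= (m + 6)%:R%:E)%E.
Proof.
have i1 n y : (\int[mu]_x ((vol n)^-1 * \1_(dyadic_cube_at n y) x)%:E = 1)%E.
  under eq_integral do rewrite EFinM.
  rewrite ge0_integralZl_EFin//; last 2 first.
  - apply/measurable_EFinP/measurable_indic.
    exact: measurable_dyadic_cube_at.
  - by rewrite invr_ge0 ltW ?vol_gt0.
  rewrite integral_indic//; last exact: measurable_dyadic_cube_at.
  rewrite setIT [X in (_ * X)%E](_ : _ = (vol n)%:E); last exact: mu_dyadic_cube_at.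
  by rewrite -EFinM mulVf ?gt_eqF ?vol_gt0.
have m1 n y : measurable_fun setT
    (fun x : Rn R d => ((vol n)^-1 * \1_(dyadic_cube_at n y) x)%:E).
  apply/measurable_EFinP; apply: measurable_funM => //.
  by apply: measurable_indic; exact: measurable_dyadic_cube_at.
have g0 n y x : (0 <= ((vol n)^-1 * \1_(dyadic_cube_at n y) x)%:E)%E.
  by rewrite lee_fin mulr_ge0// invr_ge0 ltW ?vol_gt0.
rewrite /H1_norm Lnorm1; set g := fun x => (\sum_(j < m + 5)
  ((vol (j%:Z - m%:Z))^-1 * \1_(dyadic_cube_at (j%:Z - m%:Z) (diag_pt 0)) x)%:E
  + ((vol 4%:Z)^-1 * \1_far_cube x)%:E)%E.
apply: (@le_trans _ _ (\int[mu]_x g x)%E).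
  apply: le_ge0_integralT => // x.
  have /andP[h1 h2] := dyadic_max_test_fun x.
  by rewrite gee0_abs// (le_trans h2)// /g sumEFin -EFinD.
rewrite /g ge0_integralD//; last 3 first.
- by move=> x _; apply: sume_ge0.
- by apply: emeasurable_sum => j; exact: m1.
- exact: m1.
rewrite ge0_integral_sum//.
rewrite (eq_bigr (fun=> 1%E)); last by move=> j _; exact: i1.
rewrite i1 sumEFin sumr_const card_ord -EFinD lee_fin.
by rewrite -[X in _ + X]/(1%:R) -natrD -addnA.
Qed.

Lemma H1_test_fun : H1 test_fun.
Proof.
split; first exact: integrable_test_fun.
exact: le_lt_trans H1_norm_test_fun (ltry _).
Qed.

End test_function.

(** * The lower bound on the L^1 norm of the maximal function *)

Section maximal_function.
Context (R : realType) (d m : nat).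
Hypothesis d2 : (2 <= d)%N.
Hypothesis dm : (d ^ 2 <= 2 ^ m)%N.
Implicit Types (x y : Rn R d) (j n : nat).
Local Notation mu := (lebesgue_Rn R d).
Local Notation V := (unit_ball_volume R d).
Local Notation rho := (1 + d%:R^-1 : R).
Local Notation q := (rho ^+ d).
Local Notation f := (@test_fun R d m).
Local Notation vol n := ((2 ^ n : R) ^+ d).

Let d0 : (0 < d)%N. Proof. exact: ltnW. Qed.
Let dR : 0 < d%:R :> R. Proof. by rewrite ltr0n. Qed.
Let dV0 : 0 < d%:R^-1 :> R. Proof. by rewrite invr_gt0. Qed.
Let rho_gt0 : 0 < rho. Proof. by rewrite addr_gt0. Qed.
Let rho_ge1 : 1 <= rho. Proof. by rewrite lerDl ltW. Qed.

Let rho_le : rho <= 3 / 2.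
Proof.
have : d%:R^-1 <= 2^-1 :> R by rewrite lef_pV2 ?posrE// ler_nat.
by lra.
Qed.

(** Bernoulli's inequality at exponent [d]. *)
Lemma compound_ge2 : 2 <= q.
Proof.
have h n : 1 + n%:R * d%:R^-1 <= rho ^+ n.
  elim: n => [|n IH]; first by rewrite mul0r addr0 expr0.
  rewrite exprS -natr1; apply: (@le_trans _ _ (rho * (1 + n%:R * d%:R^-1))).
    have : 0 <= n%:R * d%:R^-1 * d%:R^-1 :> R by rewrite !mulr_ge0// ltW.
    by lra.
  by rewrite ler_pM2l.
by have := h d; rewrite divff ?gt_eqF.
Qed.

(** Here q <= e, and e <= 4 since exp(-1/2) >= 1 - 1/2 gives exp(1/2) <= 2. *)
Lemma compound_le4 : q <= 4.
Proof.
have e2 : expR (2^-1) <= 2 :> R.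
  rewrite -[2^-1]opprK expRN -[leRHS]invrK lef_pV2 ?posrE ?expR_gt0 ?invr_gt0//.
  by apply: le_trans (expR_ge1Dx _); lra.
have e1 : expR 1 <= 4 :> R.
  rewrite (_ : expR 1 = expR 2^-1 ^+ 2); last by rewrite -expRM_natl divff.
  apply: (@le_trans _ _ (2 ^+ 2)); first by rewrite ler_sqr ?nnegrE ?expR_ge0.
  by rewrite -natrX.
apply: le_trans e1.
rewrite (_ : expR 1 = expR d%:R^-1 ^+ d); last first.
  by rewrite -expRM_natl divff ?gt_eqF.
by rewrite lerXn2r ?nnegrE ?expR_ge0 ?(ltW rho_gt0)// expR_ge1Dx.
Qed.

(** The coordinates of [y] sum to at most d 2^-m <= 1/d, so |x - y| <= rho^(j+1) + 1/d <= rho^(j+1)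
    (1 + 1/d) = t: after rescaling, the point is in the unit ball, where the profile is 1. *)
Lemma dil_near x y j : enorm x <= rho ^+ j.+1 -> near_cube m y ->
  dil (rho ^+ j.+2) (vsub x y) =
  (rho ^+ j.+2) ^- d * (\int[mu]_y profile y)^-1.
Proof.
move=> xj yQ; have t0 : 0 < rho ^+ j.+2 by rewrite exprn_gt0.
rewrite /dil /phi profile_eball1 ?mulr1// enorm_vscale ?invr_ge0 ?(ltW t0)//.
rewrite ler_pdivrMl// mulr1 (le_trans (enorm_vsub_le _ _))//.
rewrite [leRHS]exprSr mulrDr mulr1 lerD//.
apply: (@le_trans _ _ d%:R^-1); last by rewrite ler_peMl ?(ltW dV0)// exprn_ege1.
apply: (@le_trans _ _ (\sum_(i < d) (2 ^+ m)^-1)).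
  apply: ler_sum => i _; have /andP[y0 y1] := near_cube_itv i yQ.
  by rewrite ger0_norm// (le_trans (ltW y1))// -invr_expz.
rewrite sumr_const card_ord -[_^-1 *+ d]mulr_natl ler_pdivrMr ?exprn_gt0//.
by rewrite ler_pdivlMl// -natrX -natrM ler_nat mulnn.
Qed.

Lemma dil_far x y j : (j < d)%N -> enorm x <= rho ^+ j.+1 -> @far_cube R d y ->
  dil (rho ^+ j.+2) (vsub x y) = 0.
Proof.
move=> jd xj yP; have t0 : 0 < rho ^+ j.+2 by rewrite exprn_gt0.
rewrite /dil /phi profile_out ?mulr0// enorm_vscale ?invr_ge0 ?(ltW t0)//.
rewrite ler_pdivlMl//.
(* The first coordinate alone gives |x - y| >= 16 - 4 = 12, while the support radius is rho t =
   rho^(j+1) rho^2 <= 4 (3/2)^2 = 9. *)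
have r4 : rho ^+ j.+1 <= 4.
  by rewrite (le_trans _ compound_le4)// ler_weXn2l.
apply: (@le_trans _ _ 12); last first.
  apply: le_trans (tnth_le_enorm _ (Ordinal d0)); rewrite tnth_mktuple.
  rewrite distrC; apply: le_trans (ler_norm _).
  have := far_cube_ge (Ordinal d0) yP.
  have := le_trans (ler_norm _) (tnth_le_enorm x (Ordinal d0)).
  by move: xj r4 => /=; lra.
rewrite exprSr.
apply: (@le_trans _ _ (4 * (3 / 2) * (3 / 2))); last by lra.
by rewrite !ler_pM// ?mulr_ge0 ?exprn_ge0// ltW.
Qed.

Lemma convolution_test_fun x j : (j < d)%N -> enorm x <= rho ^+ j.+1 ->
  convolution (dil (rho ^+ j.+2)) f x =
  (rho ^+ j.+2) ^- d * (\int[mu]_y profile y)^-1.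
Proof.
move=> jd xj; rewrite /convolution; set a := _ * _.
(* The P part vanishes; it is kept with coefficient 0 to match [Rintegral_sub_indic]. *)
rewrite (_ : (fun y => _) = (fun y : Rn R d =>
    a * (vol (- m%:Z))^-1 * \1_(near_cube m) y - 0 * \1_(@far_cube R d) y)); last first.
  apply/funext => y; rewrite /test_fun mulrBr !indicE.
  have -> : dil (rho ^+ j.+2) (vsub x y) * ((vol 4%:Z)^-1 * (y \in @far_cube R d)%:R) = 0.
    case: (boolP (y \in _)) => [|_]; last by rewrite !mulr0.
    by rewrite inE => /(dil_far jd xj) ->; rewrite mul0r.
  rewrite mul0r !subr0 -[RHS]mulrA; case: (boolP (y \in _)) => [|_].
    by rewrite inE => /(dil_near xj) ->.
  by rewrite !mulr0.
rewrite (Rintegral_sub_indic _ _ measurableT (@measurable_near_cube R d m)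
  (@measurable_far_cube R d) (@mu_near_cube_fin R d m) (@mu_far_cube_fin R d)).
by rewrite mul0r subr0 setIT [X in fine X]mu_near_cube /= mulfVK// gt_eqF// vol_gt0.
Qed.

Lemma Mmax_test_fun_ge x j : (j < d)%N -> enorm x <= rho ^+ j.+1 ->
  (((q ^+ j.+2)^-1 * (q * V)^-1)%:E <= Mmax f x)%E.
Proof.
move=> jd xj; apply: (@le_trans _ _ (convolution (dil (rho ^+ j.+2)) f x)%:E).
  rewrite convolution_test_fun// lee_fin -exprM mulnC exprM.
  have V0 := unit_ball_volume_gt0 R d0.
  have /andP[h1 h2] := integral_profile_bounds R d0.
  rewrite ler_pM2l ?invr_gt0 ?exprn_gt0// lef_pV2 ?posrE//.
    by rewrite mulr_gt0// exprn_gt0.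
  exact: lt_le_trans h1.
(* The outer absolute value can only increase the supremum, so a single [t] suffices. *)
apply: le_trans (lee_abs _); apply: ereal_sup_ubound.
by exists (rho ^+ j.+2) => //=; rewrite exprn_gt0.
Qed.

(* Mmax f is bounded below on whole balls; passing to the disjoint shells keeps
   the sum of the bounds below Mmax f pointwise. *)
Let shell j : set (Rn R d) := eball (rho ^+ j.+1) `\` eball (rho ^+ j).

(** Induction on the number of shells. The vanishing outside the ball makes the earlier sum zero on
    the new shell, where only the new term has to be compared. *)
Lemma shells_le_Mmax x n : (n <= d)%N ->
  (enorm x <= rho ^+ n ->
   ((\sum_(j < n) (q ^+ j.+2)^-1 * (q * V)^-1 * \1_(shell j) x)%:E <= Mmax f x)%E)
  /\ (rho ^+ n < enorm x ->
   \sum_(j < n) (q ^+ j.+2)^-1 * (q * V)^-1 * \1_(shell j) x = 0).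
Proof.
elim: n => [|n IH] nd; first by rewrite big_ord0; split => // _; exact: abse_ge0.
have [IH1 IH2] := IH (ltnW nd); rewrite big_ord_recr /= indicE.
have rS : rho ^+ n <= rho ^+ n.+1 by rewrite ler_weXn2l.
split => xn.
  have [xn'|xn'] := leP (enorm x) (rho ^+ n).
    by rewrite memNset ?mulr0 ?addr0; [exact: IH1|case].
  rewrite IH2// mem_set ?mulr1 ?add0r; first exact: Mmax_test_fun_ge.
  by split => //; rewrite /eball /= leNgt xn'.
rewrite IH2 ?(le_lt_trans rS)// memNset ?mulr0 ?addr0//.
by case; rewrite /eball /= leNgt xn.
Qed.

Lemma mu_shell j : mu (shell j) = ((q ^+ j.+1 - q ^+ j) * V)%:E.
Proof.
have e k : mu (eball (rho ^+ k)) = (q ^+ k * V)%:E.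
  by rewrite mu_eball ?exprn_gt0// exprAC.
rewrite /shell measureD; last 3 first.
- exact: measurable_eball.
- exact: measurable_eball.
- by rewrite [X in (X < _)%E]e ltry.
rewrite [X in (X - _)%E]e setIidr.
  by rewrite [X in (_ - X)%E]e -EFinB -mulrBl.
move=> x /=; rewrite /eball /= => /le_trans; apply.
by rewrite ler_weXn2l.
Qed.

Lemma Mmax_test_fun_L1 : ((d%:R / 64)%:E <= 'N[mu]_1 [Mmax f])%E.
Proof.
have V0 := unit_ball_volume_gt0 R d0.
have q2 := compound_ge2; have q4 := compound_le4.
have q0 : 0 < q by rewrite exprn_gt0.
pose a j := (q ^+ j.+2)^-1 * (q * V)^-1.
have a0 j : 0 <= a j.
  by rewrite /a mulr_ge0// invr_ge0 ?exprn_ge0 ?mulr_ge0// ltW.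
have mS j : measurable (shell j).
  by apply: measurableD; exact: measurable_eball.
rewrite Lnorm1; apply: (@le_trans _ _
    (\int[mu]_x (\sum_(j < d) (a j * \1_(shell j) x)%:E))%E); last first.
  apply: le_ge0_integralT => x.
    by apply: sume_ge0 => j _; rewrite lee_fin mulr_ge0.
  rewrite sumEFin gee0_abs; last exact: abse_ge0.
  have [h1 h2] := shells_le_Mmax x (leqnn d).
  have [/h1//|/h2 h] := leP (enorm x) q.
  by rewrite [X in (X%:E <= _)%E]h; exact: abse_ge0.
rewrite ge0_integral_sum//; last 2 first.
- move=> j; apply/measurable_EFinP; apply: measurable_funM => //.
- by move=> j x _; rewrite lee_fin mulr_ge0.
rewrite (_ : d%:R / 64 = \sum_(j < d) 64^-1); last first.
  by rewrite sumr_const card_ord -[_^-1 *+ d]mulr_natl.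
rewrite -sumEFin; apply: lee_sum => j _.
under eq_integral do rewrite EFinM.
rewrite ge0_integralZl_EFin//; last first.
  by apply/measurable_EFinP/measurable_indic; exact: mS.
rewrite integral_indic// setIT [X in (_ * X)%E]mu_shell -EFinM lee_fin /a.
have : 0 < q ^+ j by rewrite exprn_gt0.
rewrite !exprS; move: (q ^+ j) V V0 q2 q4 q0 {a a0}.
move: (q) => p Q v v0 p2 p4 p0 Q0.
have Qv : 0 < Q * v by exact: mulr_gt0.
rewrite -invfM [leRHS]mulrC ler_pdivlMr; last first.
  by apply: mulr_gt0; apply: mulr_gt0 => //; exact: mulr_gt0.
(* Cleared of denominators, the claim for one shell is p^3 / 64 <= p - 1: the left side is at most 1
   by p <= 4, the right side at least 1 by p >= 2. *)
have p3 : p * (p * p) <= 4 * (4 * 4) by rewrite !ler_pM ?mulr_ge0// ltW.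
have p64 : 64^-1 * (p * (p * p)) <= p - 1 by lra.
by have := ler_wpM2r (ltW Qv) p64; lra.
Qed.

End maximal_function.

(** * The quotient of the two norms and the choice of constants *)

Lemma le_div_ereal (R : realType) (N H : \bar R) (a b : R) :
  0 <= a -> 0 < b -> (0 <= H)%E -> (a%:E <= N)%E -> (H <= b%:E)%E ->
  ((a / b)%:E <= N / H)%E.
Proof.
move=> a0 b0 H0 aN Hb; rewrite EFinM; apply: lee_pmul => //.
  by rewrite lee_fin invr_ge0 ltW.
have -> : (b^-1)%:E = (b%:E^-1)%E by rewrite inver gt_eqF.
by rewrite lee_pV2 ?inE// lee_fin ltW.
Qed.

Theorem mainTheorem3 (R : realType) :
  exists2 c : R, 0 < c &
    forall d : nat, (2 <= d)%N ->
      ((c * (d%:R / ln d%:R))%:E <= Mmax_opnorm R d)%E.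
Proof.
have ln2 : 0 < ln (2 : R) by rewrite ln_gt0// ltr1n.
(* 640 = 64 * 10, with 64 from the L^1 bound and 10 from [key]. *)
exists (ln 2 / 640); first by rewrite divr_gt0.
move=> d d2; have d0 : (0 < d)%N by exact: ltnW.
have /andP[ld dl] := trunc_log_bounds (isT : 1 < 2)%N d0.
set l := trunc_log 2 d in ld dl.
(* Since d < 2^(l+1), squaring gives d^2 <= 2^m. *)
pose m := (l.+1 * 2)%N.
have dm : (d ^ 2 <= 2 ^ m)%N by rewrite /m expnM leq_exp2r// ltnW.
have lnd : ln (2 : R) <= ln d%:R by rewrite ler_ln ?posrE ?ltr0n// ler_nat.
have llnd : l%:R * ln 2 <= ln (d%:R : R).
  rewrite mulr_natl -lnXn// ler_ln ?posrE ?exprn_gt0 ?ltr0n//.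
  by rewrite -natrX ler_nat.
have lnd0 := lt_le_trans ln2 lnd.
have H0 : (0 <= H1_norm (@test_fun R d m))%E.
  by rewrite /H1_norm Lnorm1; apply: integral_ge0 => x _; exact: abse_ge0.
have m0 : 0 < (m + 6)%:R :> R by rewrite ltr0n addnS.
have d64 : 0 <= d%:R / 64 :> R by [].
have := le_div_ereal d64 m0 H0 (Mmax_test_fun_L1 R d2 dm) (H1_norm_test_fun R d m).
move=> h; apply: (@le_trans _ _ (d%:R / 64 / (m + 6)%:R)%:E).
  (* Here m + 6 = 2 l + 8, with l ln 2 <= ln d, and ln 2 <= ln d because d >= 2. *)
  have key : (m + 6)%:R * ln 2 <= 10 * ln (d%:R : R).
    rewrite /m natrD natrM -natr1; lra.
  have u0 : 0 <= d%:R / ln d%:R :> R by rewrite divr_ge0// ltW.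
  have uE : d%:R / ln d%:R * ln d%:R = d%:R :> R by rewrite divfK// gt_eqF.
  rewrite lee_fin ler_pdivlMr//; have := ler_wpM2l u0 key.
  by move: u0 uE; move: (d%:R / ln d%:R) => u _ uE; lra.
apply: (le_trans h); apply: ereal_sup_ubound; exists (@test_fun R d m) => //.
by split; [exact: H1_test_fun|exact: test_fun_neq0].
Qed.
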